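(* Let $W$ be a non-negative random variable with finite mean, let $\theta>0$, and let $W^*$ have the law of $U^{1/\theta}(W+1)$, where $U\sim\mathcal U[0,1]$ is independent of $W$. Let $D_\theta$ have the generalized Dickman distribution $\mathcal D_\theta$. Then $$d_1(W,D_\theta)\le(1+\theta)\,d_1(W^*,W).$$
   Context: The generalized Dickman distribution $\mathcal D_\theta$ ($\theta>0$) is the unique law of a non-negative random variable $D_\theta$ satisfying $D_\theta=_d U^{1/\theta}(D_\theta+1)$ with $U\sim\mathcal U[0,1]$ independent of $D_\theta$. The Wasserstein distance is $d_1(X,Y)=\sup_{h\in \mathrm{Lip}_1}|Eh(X)-Eh(Y)|$, where $\mathrm{Lip}_1=\{h:|h(y)-h(x)|\le|y-x|\}$; it depends only on the laws of $X$ and $Y$. *)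

(* Defs.v *)
From HB Require Import structures.
From mathcomp Require Import all_boot all_order all_algebra.
From mathcomp Require Import all_classical all_reals all_analysis.
Set Implicit Arguments. Unset Strict Implicit. Unset Printing Implicit Defensive.
Import Order.TTheory GRing.Theory Num.Theory.
Import numFieldNormedType.Exports.
Local Open Scope classical_set_scope.
Local Open Scope ring_scope.

Definition Lip1 (R : realType) (h : R -> R) : Prop :=
  forall x y : R, `|h y - h x| <= `|y - x|.

Definition d1 (R : realType) (mu nu : set R -> \bar R) : \bar R :=
  ereal_sup [set `| (\int[mu]_x (h x)%:E - \int[nu]_x (h x)%:E)%E |%E
            | h in [set h | Lip1 h]].

Definition unif01 (R : realType) := uniform_prob (@ltr01 R).

Definition star_map (R : realType) (theta : R) (p : R * R) : R :=
  (p.1 `^ theta^-1) * (p.2 + 1).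

Definition star_law (R : realType) (theta : R) (mu : probability R R)
  : set R -> \bar R :=
  pushforward (@unif01 R \x mu)%E (star_map theta).

Definition dickman_law (R : realType) (theta : R) (nu : probability R R) : Prop :=
  nu [set x : R | x < 0] = 0%E /\
  forall A : set R, measurable A -> nu A = star_law theta nu A.

(* Main.v *)
Require Import Defs.
From HB Require Import structures.
From mathcomp Require Import all_boot all_order all_algebra.
From mathcomp Require Import all_classical all_reals all_analysis.
From mathcomp Require Import measurable_realfun.
From mathcomp Require Import ring lra.
Import Order.TTheory GRing.Theory Num.Theory.
Import numFieldNormedType.Exports.
Local Open Scope classical_set_scope.
Local Open Scope ring_scope.

(* Write [V = U^(1/theta)], so that [E V = rho = theta / (1 + theta) < 1]. For a
   [c]-Lipschitz [h], the function [x |-> E h(V (x + 1))] is [c rho]-Lipschitz, so the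
   map [mu |-> star mu] contracts [d1] by [rho]. It fixes [nu], so the triangle inequality
   gives [d1 (mu, nu) <= d1 (star mu, mu) + rho d1 (mu, nu)], and [1 / (1 - rho) = 1 + theta].
   Dividing requires [d1 (mu, nu)] to be finite, so that [nu] must be shown to have a
   finite mean: iterating [D =_d V (D + 1)] inside the bounded function [min M |x|] yields
   [E min(M, |D|) <= rho + rho^2 + ... + E min(M, rho^k |D|)], whose right-hand side
   tends to [theta], uniformly in [M]. *)

(** * Integrals of powers over the unit interval *)

Lemma powR_cvg_at_right0 (R : realType) (a : R) : 0 < a ->
  x `^ a @[x --> 0^'+] --> (0 : R).
Proof.
move=> a0; apply/cvgrPdist_lt => e e0.
near=> x.
have x0 : 0 < x by near: x; exact: nbhs_right_gt.
rewrite sub0r normrN ger0_norm ?powR_ge0//.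
have -> : e = (e `^ a^-1) `^ a by rewrite -powRrM mulVf ?gt_eqF// powRr1// ltW.
rewrite gt0_ltr_powR ?nnegrE ?powR_ge0 ?ltW//.
near: x; apply: nbhs_right_lt; exact: powR_gt0.
Unshelve. all: by end_near. Qed.

(** An exponent below 1 gives no derivative at 0, so the fundamental theorem of calculus is fed
    derivability inside the interval and one-sided limits at its ends. *)
Lemma powR_derivable_oo_LRcontinuous (R : realType) (a : R) : 0 < a ->
  derivable_oo_LRcontinuous (fun x : R => x `^ a) 0 1.
Proof.
move=> a0; split.
- move=> x; rewrite in_itv/= => /andP[x0 _].
  by apply: derivable_powR; rewrite in_itv/= x0.
- by rewrite powR0 ?gt_eqF//; exact: powR_cvg_at_right0.
- apply: cvg_at_left_filter.
  have : derivable (fun x : R => x `^ a) 1 1.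
    by apply: derivable_powR; rewrite in_itv/= ltr01.
  by move/derivable1_diffP/differentiable_continuous.
Qed.

Lemma integral_powR01 (R : realType) (a : R) : 0 < a ->
  (\int[lebesgue_measure]_(x in `[0%R, 1%R]) (x `^ a)%:E = ((a + 1)^-1)%:E)%E.
Proof.
move=> a0; have a10 : 0 < a + 1 by rewrite addr_gt0.
have a1N0 : a + 1 != 0 by rewrite gt_eqF.
pose F (x : R) := (a + 1)^-1 * x `^ (a + 1).
have [dF F0 F1] := @powR_derivable_oo_LRcontinuous R _ a10.
rewrite (@continuous_FTC2 _ _ F) ?ltr01//.
- by rewrite /F powR0// mulr0 powR1 mulr1 sube0.
- exact/derivable_oo_LRcontinuous_within/powR_derivable_oo_LRcontinuous.
- split.
  + by move=> x x01; apply: derivableM => //; exact: dF.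
  + by apply: cvgM; [exact: cvg_cst|exact: F0].
  + by apply: cvgM; [exact: cvg_cst|exact: F1].
- move=> x; rewrite in_itv/= => /andP[x0 x1].
  rewrite /F derive1E deriveZ; last by apply: dF; rewrite in_itv/= x0.
  rewrite -derive1E powR_derive1 ?in_itv/= ?x0//.
  by rewrite addrK /GRing.scale/= mulrA mulVf// mul1r.
Qed.

(** * Lipschitz test functions and the averaging operator dual to the star map *)

Section smoothing.
Context {R : realType}.
Implicit Types (h : R -> R) (c x y : R).

Definition Lip c h : Prop := forall x y, `|h y - h x| <= c * `|y - x|.

Lemma Lip_measurable c h : Lip c h -> measurable_fun setT h.
Proof.
move=> Lh; apply: continuous_measurable_fun => x.
have c0 : 0 <= c.
  by have := le_trans (normr_ge0 _) (Lh 0 1); rewrite subr0 normr1 mulr1.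
apply/cvgrPdist_lt => e e0; near=> y.
rewrite (le_lt_trans (Lh _ _))//.
(* The denominator is [c + 1] because [c] may be 0. *)
have : `|x - y| < e / (c + 1).
  by near: y; apply: cvgr_dist_lt => //; rewrite divr_gt0 ?ltr_wpDl.
rewrite ltr_pdivlMr ?ltr_wpDl// => /(le_lt_trans _); apply.
by rewrite mulrC ler_wpM2l// lerDl.
Unshelve. all: by end_near. Qed.

Lemma Lip_norm_le c h x : Lip c h -> `|h x| <= `|h 0| + c * `|x|.
Proof.
move=> /(_ 0 x); rewrite subr0 -lerBlDl; apply: le_trans.
exact: lerB_dist.
Qed.

Lemma Lip_integrable (P : probability R R) c h : 0 <= c -> Lip c h ->
  P.-integrable setT (fun x => x%:E) -> P.-integrable setT (EFin \o h).
Proof.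
move=> c0 Lh iP.
have iP' : P.-integrable setT (EFin \o (fun x => `|h 0| + c * `|x|)).
  apply: (@integrableD _ _ _ P setT measurableT (cst `|h 0|%:E)
    (fun x => (c%:E * `|x%:E|)%E)).
    exact: finite_measure_integrable_cst.
  by apply: integrableZl => //; exact: integrable_abse.
apply: le_integrable iP' => //.
  apply/measurable_EFinP. exact: (Lip_measurable c h Lh).
move=> x _ /=; rewrite lee_fin [leRHS]ger0_norm ?addr_ge0 ?mulr_ge0//.
exact: Lip_norm_le.
Qed.

Lemma Lip_bounded_integrable (P : probability R R) (M : R) c h : Lip c h ->
  (forall x, 0 <= h x <= M) -> P.-integrable setT (EFin \o h).
Proof.
move=> Lh hM; apply: (@le_integrable _ _ _ _ _ measurableT _ (cst M%:E)).
- by apply/measurable_EFinP; exact: (Lip_measurable c h Lh).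
- move=> x _; case/andP: (hM x) => h0 hx.
  by rewrite /= lee_fin !ger0_norm// (le_trans h0).
- exact: finite_measure_integrable_cst.
Qed.

Variables (theta : R).
Hypothesis theta0 : 0 < theta.

Let U : probability _ R := uniform_prob (@ltr01 R).
Let V (u : R) := u `^ theta^-1.

Definition contraction_factor : R := theta / (1 + theta).
Local Notation rho := contraction_factor.

Lemma contraction_factor_ge0 : 0 <= rho.
Proof. by rewrite /rho divr_ge0// ltW// addr_gt0. Qed.

Let mV : measurable_fun setT V.
Proof. exact: measurable_powR. Qed.

Let V_ge0 u : 0 <= V u. Proof. exact: powR_ge0. Qed.

Let integral_V : (\int[U]_u (V u)%:E)%E = rho%:E.
Proof.
rewrite integral_uniform//; last exact/measurable_EFinP.
rewrite integral_powR01 ?invr_gt0// subr0 invr1 mul1e; congr EFin.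
rewrite /rho; field.
by rewrite !gt_eqF ?addr_gt0.
Qed.

Let integrable_V c : U.-integrable setT (fun u => (V u * c)%:E).
Proof.
have iV : U.-integrable setT (EFin \o V).
  apply/integrableP; split; first exact/measurable_EFinP.
  under eq_integral do rewrite /= ger0_norm//.
  by rewrite integral_V ltry.
under eq_fun do rewrite mulrC EFinM.
exact: integrableZl.
Qed.

(** The adjoint of [star_law]: it moves the star transform from the law to the test function. Being
    real-valued, it can be iterated and is itself a test function. *)
Definition smooth h (y : R) : R :=
  \int[uniform_prob (@ltr01 R)]_u h (u `^ theta^-1 * (y + 1)).

Let integrable_smooth c h y : 0 <= c -> Lip c h ->
  U.-integrable setT (fun u => (h (V u * (y + 1)))%:E).
Proof.
move=> c0 Lh.
have i1 : U.-integrable setT (EFin \o (fun u => `|h 0| + V u * (c * `|y + 1|))).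
  apply: (@integrableD _ _ _ U setT measurableT
    (cst `|h 0|%:E) (fun u => (V u * (c * `|y + 1|))%:E)) => //.
  exact: finite_measure_integrable_cst.
apply: le_integrable i1 => //.
  apply/measurable_EFinP; apply: measurableT_comp; first exact: (Lip_measurable _ _ Lh).
  exact: measurable_funM.
move=> x _ /=; rewrite lee_fin [leRHS]ger0_norm ?addr_ge0 ?mulr_ge0//.
by rewrite (le_trans (Lip_norm_le _ _ _ Lh))// normrM ger0_norm// mulrCA.
Qed.

(** Couple the two averages through the same [u]: the arguments of [h] then differ by
    [V u * (y - x)], and [V] has mean [rho]. *)
Lemma smooth_Lip c h : 0 <= c -> Lip c h -> Lip (c * rho) (smooth h).
Proof.
move=> c0 Lh x y.
pose g z u := h (V u * (z + 1)).
have ig z : U.-integrable setT (fun u => (g z u)%:E).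
  exact: (integrable_smooth _ _ _ _ Lh).
have iB : U.-integrable setT (EFin \o (fun u => g y u - g x u)).
  exact: (@integrableB _ _ _ U setT measurableT _ _ (ig y) (ig x)).
rewrite /smooth -(RintegralB measurableT (ig y) (ig x)).
apply: (le_trans (le_normr_Rintegral measurableT iB)).
apply: (@le_trans _ _ (\int[U]_u (V u * (c * `|y - x|)))).
  apply: (le_Rintegral measurableT (integrable_norm iB) (integrable_V _)).
  move=> u _; apply: (le_trans (Lh _ _)).
  have -> : V u * (y + 1) - V u * (x + 1) = V u * (y - x) by ring.
  by rewrite normrM (ger0_norm (V_ge0 _)) mulrCA.
rewrite RintegralZr// /Rintegral; last first.
  by have := integrable_V 1; under eq_fun do rewrite mulr1.
by rewrite integral_V/= mulrCA mulrA.
Qed.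

Lemma smooth_bound (M : R) c h y : 0 <= c -> Lip c h ->
  (forall x, 0 <= h x <= M) -> 0 <= smooth h y <= M.
Proof.
move=> c0 Lh hM; apply/andP; split.
  by apply: Rintegral_ge0 => u _; case/andP: (hM (u `^ theta^-1 * (y + 1))).
rewrite -[leRHS]mulr1.
have -> : 1 = fine (U setT) by rewrite probability_setT.
rewrite -Rintegral_cst//; apply: le_Rintegral => //.
- exact: (integrable_smooth _ _ _ _ Lh).
- exact: finite_measure_integrable_cst.
- by move=> u _; case/andP: (hM (u `^ theta^-1 * (y + 1))).
Qed.

Lemma measurable_star_map :
  @measurable_fun _ _ (measurableTypeR R * R)%type R setT (star_map theta).
Proof.
apply: measurable_funM.
  exact: measurableT_comp (measurable_powR _) measurable_fst.
by apply: measurable_funD => //; exact: measurable_snd.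
Qed.

(** Change of variables along [star_map], then Fubini. The assumption on the smoothing of [|h|] is
    Tonelli's criterion for integrability on the product. *)
Lemma integral_star_law (P : probability R R) c h : 0 <= c -> Lip c h ->
  P.-integrable setT (EFin \o smooth (fun x => `|h x|)) ->
  (\int[star_law theta P]_x (h x)%:E = \int[P]_x (smooth h x)%:E)%E.
Proof.
move=> c0 Lh iP.
have Ln : Lip c (fun x => `|h x|).
  by move=> x y; rewrite (le_trans (ler_dist_dist _ _)).
have ih : (U \x P)%E.-integrable setT (fun p => (h (star_map theta p))%:E).
  apply/integrable21ltyP.
    apply/measurable_EFinP; apply: measurableT_comp measurable_star_map.
    exact: (Lip_measurable _ _ Lh).
  move: (iP) => /(integrable_lty measurableT); congr (_ < _)%E.
  apply: eq_integral => y _; rewrite /= /smooth /Rintegral fineK//.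
  by apply: integrable_fin_num => //; exact: (integrable_smooth _ _ _ _ Ln).
rewrite /star_law /unif01 (integral_pushforward measurable_star_map)//=.
- rewrite -integral21_prod_meas1//; apply: eq_integral => y _.
  rewrite /fubini_G /smooth /Rintegral fineK//.
  by apply: integrable_fin_num => //; exact: (integrable_smooth _ _ _ _ Lh).
- by apply/measurable_EFinP; exact: (Lip_measurable _ _ Lh).
Qed.

(** This version asks for no moment of [P], so it applies to the Dickman law before its mean is
    known to be finite. *)
Lemma integral_star_law_bounded (P : probability R R) (M : R) c h :
  0 <= c -> Lip c h -> (forall x, 0 <= h x <= M) ->
  (\int[star_law theta P]_x (h x)%:E = \int[P]_x (smooth h x)%:E)%E.
Proof.
move=> c0 Lh hM; apply: (integral_star_law _ _ _ c0 Lh).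
rewrite (_ : (fun x => `|h x|) = h); last first.
  by apply/funext => x; rewrite ger0_norm//; case/andP: (hM x).
apply: (Lip_bounded_integrable _ M _ _ (smooth_Lip _ _ c0 Lh)) => x.
exact: smooth_bound c0 Lh hM.
Qed.

Lemma integral_star_law_integrable (P : probability R R) c h :
  0 <= c -> Lip c h -> P.-integrable setT (fun x => x%:E) ->
  (\int[star_law theta P]_x (h x)%:E = \int[P]_x (smooth h x)%:E)%E.
Proof.
move=> c0 Lh iP; apply: (integral_star_law _ _ _ c0 Lh).
apply: (Lip_integrable _ (c * rho)) => //.
  by rewrite mulr_ge0// contraction_factor_ge0.
apply: smooth_Lip => // x y.
by rewrite (le_trans (ler_dist_dist _ _)).
Qed.

End smoothing.

(** * Finite mean of the Dickman law *)

Section first_moment.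
Context {R : realType}.
Variables (theta : R) (nu : probability R R).
Hypotheses (theta0 : 0 < theta) (nuD : dickman_law theta nu).
Implicit Types (h : R -> R) (c M : R).
Local Notation rho := (contraction_factor theta).

Lemma dickman_integral (f : R -> \bar R) :
  (\int[nu]_x f x = \int[star_law theta nu]_x f x)%E.
Proof.
case: nuD => _; rewrite /star_law /unif01 => nuE.
apply: eq_measure_integral; first exact: measurable_star_map.
by move=> mstar A mA _; exact: nuE.
Qed.

(** Truncations stand in for [c * |x|]: they are bounded, hence integrable whatever the tails of the
    law, and capping at [M] does not increase distances. *)
Lemma Lip_truncation c M : 0 <= c -> Lip c (fun x : R => Num.min M (c * `|x|)).
Proof.
move=> c0 x y.
apply: (@le_trans _ _ (`|c * `|y| - c * `|x| |)).
  move: (c * `|y|) (c * `|x|) => p q.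
  have [yM|yM] := leP M p; have [xM|xM] := leP M q.
  - by rewrite subrr normr0.
  - by rewrite !ger0_norm; lra.
  - by rewrite !ler0_norm; lra.
  - by [].
by rewrite -mulrBr normrM ger0_norm// ler_wpM2l// ler_dist_dist.
Qed.

Lemma truncation_bound c M (x : R) : 0 <= c -> 0 <= M ->
  0 <= Num.min M (c * `|x|) <= M.
Proof. by move=> c0 M0; rewrite le_min M0 mulr_ge0//= ge_min lexx. Qed.

Lemma integrable_truncation c M : 0 <= c -> 0 <= M ->
  nu.-integrable setT (EFin \o (fun x : R => Num.min M (c * `|x|))).
Proof.
move=> c0 M0; apply: (Lip_bounded_integrable _ M c _ (Lip_truncation _ _ c0)) => x.
exact: truncation_bound.
Qed.

(* Unrolling [D =_d V (D + 1)] once replaces [h] by [x |-> E h(V x)] at the cost of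
   [c * rho] and multiplies the Lipschitz constant by [rho]; all costs sum to
   [c * theta]. *)
Lemma dickman_bounded_expectation k c M h : 0 <= c -> Lip c h ->
  (forall x, 0 <= h x <= M) -> h 0 = 0 ->
  \int[nu]_x h x <=
  c * theta + \int[nu]_x Num.min M (c * rho ^+ k * `|x|).
Proof.
have rho0 := contraction_factor_ge0 _ theta0.
elim: k c h => [|k IH] c h c0 Lh hM h0.
  have M0 : 0 <= M by case/andP: (hM 0) => /le_trans; apply.
  rewrite expr0 mulr1 -[leLHS]add0r lerD ?mulr_ge0 ?(ltW theta0)//.
  apply: le_Rintegral => //.
  - exact: (Lip_bounded_integrable _ M c).
  - exact: integrable_truncation.
  move=> x _; rewrite le_min; case/andP: (hM x) => hx0 ->/=.
  rewrite (le_trans (ler_norm _))// (le_trans (Lip_norm_le _ _ _ Lh))//.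
  by rewrite h0 normr0 add0r.
(* The shift by 1 restores the invariant [g 0 = 0], since [g 0] averages [h (V u * 0)]. Undoing it
   costs one Lipschitz constant, [c * rho]. *)
pose g x := smooth theta h (x - 1).
have Lsm := smooth_Lip _ theta0 _ _ c0 Lh.
have Lg : Lip (c * rho) g.
  by move=> x y; rewrite (le_trans (Lsm _ _))// opprB addrA subrK.
have gM x : 0 <= g x <= M by exact: (smooth_bound _ theta0 _ c).
have g0 : g 0 = 0.
  rewrite /g /smooth sub0r addNr.
  under eq_Rintegral do rewrite mulr0 h0.
  by rewrite Rintegral_cst// mul0r.
have ig := Lip_bounded_integrable nu M _ _ Lg gM.
have -> : \int[nu]_x h x = \int[nu]_x smooth theta h x.
  by rewrite /Rintegral dickman_integral (integral_star_law_bounded _ theta0 _ M c).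
have ic : nu.-integrable setT (EFin \o cst (c * rho)).
  exact: finite_measure_integrable_cst.
apply: (@le_trans _ _ (\int[nu]_x (g x + cst (c * rho) x))).
  apply: le_Rintegral => //.
  - apply: (Lip_bounded_integrable _ M _ _ Lsm) => x.
    exact: (smooth_bound _ theta0 _ c).
  - exact: (@integrableD _ _ _ nu setT measurableT _ _ ig ic).
  move=> x _; rewrite /= -lerBlDl (le_trans (ler_norm _))// (le_trans (Lsm _ _))//.
  by rewrite opprB addrC subrK normr1 mulr1.
rewrite RintegralD// Rintegral_cst//.
have -> : fine (nu setT) = 1 by rewrite probability_setT.
have crho0 : 0 <= c * rho by rewrite mulr_ge0.
have := IH _ _ crho0 Lg gM g0.
rewrite -(mulrA c _ (_ ^+ _)) -exprS mulr1 => H.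
(* The identity [theta = rho * (theta + 1)] absorbs the new cost into the bound of the induction
   hypothesis. *)
have -> : c * theta = c * rho * theta + c * rho.
  by rewrite /contraction_factor; field; rewrite gt_eqF// addr_gt0.
by rewrite addrAC lerD2r.
Qed.

Lemma contraction_factor_lt1 : rho < 1.
Proof. by rewrite /contraction_factor ltr_pdivrMr ?addr_gt0// mul1r ltrDr. Qed.

(** Dominated convergence with the constant [M] as dominating function; pointwise, [rho ^+ k * |x|]
    tends to 0 because [rho < 1]. *)
Lemma cvg_truncation M : 0 <= M ->
  \int[nu]_x Num.min M (rho ^+ k * `|x|) @[k --> \oo] --> (0 : R).
Proof.
move=> M0.
have rho0 := contraction_factor_ge0 _ theta0.
have rk0 k : 0 <= rho ^+ k by rewrite exprn_ge0.
have mt k : measurable_fun setT (fun x : R => (Num.min M (rho ^+ k * `|x|))%:E).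
  apply/measurable_EFinP; exact: (Lip_measurable _ _ (Lip_truncation _ _ _)).
have [//|||||_ _] := @dominated_convergence _ _ R nu setT measurableT
  (fun k x => (Num.min M (rho ^+ k * `|x|))%:E) (cst 0%E) (cst M%:E).
- exact: measurable_cst.
- apply: aeW => x _; apply: cvg_EFin; first exact: nearW.
  apply: (@squeeze_cvgr _ _ _ _ (cst 0) (fun k => rho ^+ k * `|x|)).
  + apply: nearW => k; rewrite /= ge_min lexx orbT andbT.
    by case/andP: (truncation_bound (rho ^+ k) M x (rk0 k) M0).
  + exact: cvg_cst.
  + rewrite -[X in _ --> X](mul0r `|x|); apply: cvgMl.
    by apply: cvg_expr; rewrite ger0_norm// contraction_factor_lt1.
- exact: finite_measure_integrable_cst.
- apply: aeW => x k _ /=; rewrite lee_fin.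
  have [t0 tM] := andP (truncation_bound (rho ^+ k) M x (rk0 k) M0).
  by rewrite ger0_norm.
rewrite integral0 => /fine_cvg; exact.
Qed.

(** Unrolling [k] times bounds the left side by [theta] plus a remainder that vanishes as [k] grows.
    The limit no longer depends on [M]. *)
Lemma dickman_truncated_moment M : 0 <= M ->
  \int[nu]_x Num.min M `|x| <= theta.
Proof.
move=> M0.
have trunc1 : (fun x : R => Num.min M `|x|) = (fun x => Num.min M (1 * `|x|)).
  by apply/funext => x; rewrite mul1r.
have cvg_bound :
    theta + \int[nu]_x Num.min M (rho ^+ k * `|x|) @[k --> \oo] --> theta + 0.
  by apply: cvgD; [exact: cvg_cst|exact: cvg_truncation].
rewrite -[leRHS]addr0; apply: (cvgr_to_ge cvg_bound).
apply: nearW => k.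
rewrite trunc1.
have := dickman_bounded_expectation k 1 M _ ler01 (Lip_truncation 1 M ler01) _ _.
rewrite !mul1r; apply.
- by move=> x; exact: truncation_bound.
- by rewrite normr0 min_r.
Qed.

(** Monotone convergence along integer truncation levels turns the uniform bound into a bound on the
    mean of [|x|]. *)
Lemma dickman_integrable : nu.-integrable setT (fun x : R => x%:E).
Proof.
apply/integrableP; split; first exact/measurable_EFinP.
apply: (@le_lt_trans _ _ theta%:E); last exact: ltry.
have cvg_trunc (x : R) : ((Num.min k%:R `|x|)%:E @[k --> \oo] --> `|x%:E|)%E.
  rewrite abse_EFin.
  (* For fixed [x] the sequence is constant once [k] exceeds [|x|]. *)
  apply: cvg_near_cst.
  near=> k; congr EFin; apply: min_r; near: k; exact: nbhs_infty_ger.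
have itr (k : nat) : nu.-integrable setT (fun x : R => (Num.min k%:R `|x|)%:E).
  have := integrable_truncation 1 k%:R ler01 (ler0n _ k).
  by under eq_fun do rewrite /= mul1r.
rewrite (eq_integral (fun x : R => limn (fun k => (Num.min k%:R `|x|)%:E))); last first.
  by move=> x _; apply/esym/cvg_lim.
apply: (cvge_to_le (cvg_monotone_convergence _ _ _ _)) => //.
- by move=> k; exact: (measurable_int nu (itr k)).
- move=> x _ m n mn; rewrite lee_fin le_min !ge_min lexx orbT andbT.
  by rewrite ler_nat mn.
- apply: nearW => k; rewrite -(@fineK _ (integral _ _ _)).
    by rewrite lee_fin; exact: dickman_truncated_moment.
  by apply: integrable_fin_num => //; exact: itr.
Unshelve. all: by end_near. Qed.

End first_moment.

(** * The Wasserstein distance between laws with finite mean *)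

Section wasserstein.
Context {R : realType}.

Lemma Lip1P (h : R -> R) : Lip1 h <-> Lip 1 h.
Proof. by split=> Lh x y; have := Lh x y; rewrite mul1r. Qed.

Lemma d1_ubound (mu nu : set R -> \bar R) (h : R -> R) : Lip1 h ->
  (`| \int[mu]_x (h x)%:E - \int[nu]_x (h x)%:E | <= d1 mu nu)%E.
Proof. by move=> Lh; apply: ereal_sup_ubound; exists h. Qed.

Lemma d1_ge0 (mu nu : set R -> \bar R) : (0 <= d1 mu nu)%E.
Proof.
apply: le_trans (d1_ubound mu nu (cst 0) _); first exact: abse_ge0.
by move=> x y; rewrite subrr normr0.
Qed.

Section integrable_laws.
Variables mu nu : probability R R.
Hypotheses (imu : mu.-integrable setT (fun x : R => x%:E)).
Hypotheses (inu : nu.-integrable setT (fun x : R => x%:E)).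

Lemma dist_integralE (c : R) (h : R -> R) : 0 <= c -> Lip c h ->
  `| \int[mu]_x (h x)%:E - \int[nu]_x (h x)%:E |%E =
  `| \int[mu]_x h x - \int[nu]_x h x |%:E.
Proof.
move=> c0 Lh; rewrite /Rintegral -[in LHS](@fineK _ (\int[mu]_x (h x)%:E)%E).
  rewrite -[in LHS](@fineK _ (\int[nu]_x (h x)%:E)%E)//.
  exact/integrable_fin_num/(Lip_integrable _ c).
exact/integrable_fin_num/(Lip_integrable _ c).
Qed.

(** Compare both laws with the point mass at 0: each lies within its own mean of [|x|], uniformly in
    the test function. *)
Lemma d1_fin_num : d1 mu nu \is a fin_num.
Proof.
have ibound (P : probability R R) : P.-integrable setT (fun x : R => x%:E) ->
    forall h : R -> R, Lip 1 h -> `| \int[P]_x h x - h 0 | <= \int[P]_x `|x|.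
  move=> iP h Lh.
  have ih := Lip_integrable P 1 h ler01 Lh iP.
  have ic : P.-integrable setT (EFin \o cst (h 0)).
    exact: finite_measure_integrable_cst.
  have -> : h 0 = \int[P]_x cst (h 0) x.
    by rewrite Rintegral_cst// (_ : fine (P setT) = 1) ?mulr1// probability_setT.
  have iB := @integrableB _ _ _ P setT measurableT _ _ ih ic.
  rewrite -(RintegralB measurableT ih ic).
  apply: (le_trans (le_normr_Rintegral measurableT iB)).
  apply: (le_Rintegral measurableT (integrable_norm iB) (integrable_norm iP)).
  by move=> x _; have := Lh 0 x; rewrite mul1r subr0.
rewrite ge0_fin_numE ?d1_ge0//.
apply: (@le_lt_trans _ _ (\int[mu]_x `|x| + \int[nu]_x `|x|)%:E); last exact: ltry.
apply: ub_ereal_sup => _ [h /Lip1P Lh <-].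
rewrite (dist_integralE 1)// lee_fin.
have := ibound _ imu _ Lh; have := ibound _ inu _ Lh.
rewrite -[in `|_ - _| <= _ + _](subrKA (h 0)) => Hnu Hmu.
by rewrite (le_trans (ler_normD _ _))// lerD// distrC.
Qed.

(** Dividing [h] by [c] makes it an admissible test function for [d1]. *)
Lemma dist_Rintegral_le (c : R) (h : R -> R) : 0 < c -> Lip c h ->
  `| \int[mu]_x h x - \int[nu]_x h x | <= c * fine (d1 mu nu).
Proof.
move=> c0 Lh.
have Lch : Lip 1 (fun x => c^-1 * h x).
  move=> x y; rewrite -mulrBr normrM gtr0_norm ?invr_gt0// mul1r.
  by rewrite ler_pdivrMl.
have := d1_ubound mu nu _ ((Lip1P _).2 Lch).
rewrite (dist_integralE 1)// -[leRHS](fineK d1_fin_num) lee_fin.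
rewrite !RintegralZl//; [|exact: (Lip_integrable _ c _ (ltW c0))..].
rewrite -mulrBr normrM gtr0_norm ?invr_gt0//.
by rewrite ler_pdivrMl.
Qed.

End integrable_laws.
End wasserstein.

Theorem theorem1p5 (R : realType) (theta : R) (mu nu : probability R R) :
  0 < theta ->
  mu [set x : R | x < 0] = 0%E ->
  mu.-integrable setT (fun x : R => x%:E) ->
  dickman_law theta nu ->
  (d1 mu nu <= (1 + theta)%:E * d1 (star_law theta mu) mu)%E.
Proof.
move=> theta0 _ imu nuD.
have inu := dickman_integrable _ _ theta0 nuD.
have theta10 : 0 < 1 + theta by rewrite addr_gt0.
have d1_fin := d1_fin_num _ _ imu inu.
have := d1_ge0 (star_law theta mu) mu.
(* If this distance is infinite the bound is trivial, which spares a moment estimate for the starred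
   law; nonnegativity rules out [-oo]. *)
case star_d1 : (d1 (star_law theta mu) mu) => [b| |] //; last first.
  by rewrite gt0_muley ?leey// lte_fin.
rewrite lee_fin => b0.
set d := fine (d1 mu nu).
rewrite -(fineK d1_fin) -EFinM lee_fin -/d.
pose rho := contraction_factor theta.
have rho0 : 0 < rho by rewrite divr_gt0.
suff : d <= b + rho * d.
  rewrite -lerBlDr => le_d.
  have -> : d = (1 + theta) * (d - rho * d).
    by rewrite /rho /contraction_factor; field; rewrite gt_eqF.
  by rewrite ler_pM2l.
(* The left side becomes a supremum again, so that each test function can be bounded separately. *)
rewrite -lee_fin /d (fineK d1_fin) -/d.
apply: ub_ereal_sup => _ [h Lip1h <-].
have Lh := (Lip1P _).1 Lip1h.
have Lsm : Lip rho (smooth theta h).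
  by rewrite -[rho]mul1r; exact: smooth_Lip.
rewrite (dist_integralE _ _ imu inu 1)// lee_fin.
have -> : \int[nu]_x h x = \int[nu]_x smooth theta h x.
  rewrite /Rintegral (dickman_integral theta)//.
  by rewrite (integral_star_law_integrable _ theta0 _ 1).
(* The inserted term splits the difference in two: [h] tested on the star of [mu] against [mu], at
   most [b], and the [rho]-Lipschitz [smooth theta h] tested on [mu] against [nu], at most
   [rho * d]. *)
rewrite -(subrKA (\int[mu]_x smooth theta h x)).
apply: (le_trans (ler_normD _ _)); apply: lerD; last exact: dist_Rintegral_le.
have := d1_ubound (star_law theta mu) mu h Lip1h.
rewrite star_d1 (integral_star_law_integrable _ theta0 _ 1)//.
have fin1 : (\int[mu]_x (h x)%:E)%E \is a fin_num.
  exact/integrable_fin_num/(Lip_integrable _ 1).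
have fin2 : (\int[mu]_x (smooth theta h x)%:E)%E \is a fin_num.
  exact/integrable_fin_num/(Lip_integrable _ rho _ (ltW rho0)).
by rewrite -(fineK fin1) -(fineK fin2) -EFinB lee_fin distrC.
Qed.
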